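(* Let $\mathbb{A}=(a_{i_1i_2\ldots i_m})$ be a nonnegative tensor of order $m$ and dimension $n$. Suppose that for each $s\in[n]$ there is a word $\alpha_s\in[n]^{m-1}$ such that $a_{i\alpha_s}=0$ for every $i\in[n]$ and every $s\in[n]\setminus\{i\}$. Then $\mathbb{A}$ is not strongly primitive.
   Context: $[n]=\{1,\ldots,n\}$; for $i\in[n]$ and $\alpha=i_2\ldots i_m\in[n]^{m-1}$, $a_{i\alpha}=a_{ii_2\ldots i_m}$. General product: for $\mathbb{A}$ of order $m\ge2$ and $\mathbb{B}$ of order $k\ge1$, both of dimension $n$, $\mathbb{A}\mathbb{B}$ is the order $(m-1)(k-1)+1$ tensor with $(\mathbb{A}\mathbb{B})_{i\alpha_1\ldots\alpha_{m-1}}=\sum_{i_2,\ldots,i_m=1}^n a_{ii_2\ldots i_m}b_{i_2\alpha_1}\cdots b_{i_m\alpha_{m-1}}$ ($\alpha_j\in[n]^{k-1}$); it is associative, $\mathbb{A}^1=\mathbb{A}$, $\mathbb{A}^k=\mathbb{A}\mathbb{A}^{k-1}$. A nonnegative tensor $\mathbb{A}$ is strongly primitive if $\mathbb{A}^k$ is positive (all entries $>0$) for some positive integer $k$.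
   Formalization: The dimension is assumed to satisfy n ≥ 2; for n = 1 the condition on the words is vacuous and the tensor with single entry 1 is strongly primitive, so the statement fails there. *)

(* Defs.v *)
From mathcomp Require Import all_boot all_order all_algebra.
From mathcomp Require Import reals.

Set Implicit Arguments.
Unset Strict Implicit.
Unset Printing Implicit Defensive.

Import Order.TTheory GRing.Theory Num.Theory.
Local Open Scope ring_scope.

(* A tensor of order m >= 1 and dimension n, with the first index separated:
   the entry a_{i alpha}, alpha in [n]^(m-1), is A i alpha.  The index set [n]
   is 'I_n.  (Order 0 is not meaningful here.) *)
Definition tensor (R : Type) (m n : nat) := 'I_n -> (m.-1).-tuple 'I_n -> R.

Lemma block_subproof (p q : nat) (j : 'I_p) (l : 'I_q) : (j * q + l < p * q)%N.
Proof.
apply: (@leq_trans (j.+1 * q)); last by rewrite leq_mul2r ltn_ord orbT.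
by rewrite mulSn addnC ltn_add2r.
Qed.

(* The factor alpha_j of a word alpha_0 ... alpha_(p-1) of length p * q, each
   alpha_j having length q. *)
Definition block (T : Type) (p q : nat) (w : (p * q).-tuple T) (j : 'I_p) :
    q.-tuple T :=
  [tuple tnth w (Ordinal (block_subproof j l)) | l < q].

Definition tensor_mul (R : realType) (m k n : nat)
    (A : tensor R m n) (B : tensor R k n) :
    tensor R (m.-1 * k.-1).+1 n :=
  fun i w => \sum_(v : (m.-1).-tuple 'I_n)
    A i v * \prod_(j < m.-1) B (tnth v j) (block w j).

(* Powers are only meaningful for positive exponents: A^1 = A and
   A^k = A A^(k-1); the value A at exponent 0 is a dummy. *)
Fixpoint tensor_pow_order (m k : nat) : nat :=
  match k with
  | 0 => m
  | k'.+1 => match k' with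
             | 0 => m
             | _.+1 => (m.-1 * (tensor_pow_order m k').-1).+1
             end
  end.

Fixpoint tensor_pow (R : realType) (m n : nat) (A : tensor R m n) (k : nat) :
    tensor R (tensor_pow_order m k) n :=
  match k return tensor R (tensor_pow_order m k) n with
  | 0 => A
  | k'.+1 =>
      match k' return tensor R (tensor_pow_order m k') n ->
                      tensor R (tensor_pow_order m k'.+1) n with
      | 0 => fun _ => A
      | _.+1 => fun B => tensor_mul A B
      end (@tensor_pow R m n A k')
  end.

Arguments tensor_pow {R m n} A k _ _.

Definition nonneg_tensor (R : realType) (m n : nat) (A : tensor R m n) : Prop :=
  forall i alpha, 0 <= A i alpha.

Definition pos_tensor (R : realType) (m n : nat) (A : tensor R m n) : Prop :=
  forall i alpha, 0 < A i alpha.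

Definition strongly_primitive (R : realType) (m n : nat) (A : tensor R m n) :
    Prop :=
  exists k : nat, (0 < k)%N /\ pos_tensor (tensor_pow A k).

(* Main.v *)
Require Import Defs.
From mathcomp Require Import all_boot all_order all_algebra.
From mathcomp Require Import reals.

Import Order.TTheory GRing.Theory Num.Theory.
Local Open Scope ring_scope.

(** Call a tensor separating if every [s] has a word whose column vanishes off
    row [s]; the hypothesis says that [A] is separating. Separation is stable
    under products: for the word of [s] in [AB], concatenate the words of [B]
    attached to the letters of the word [alpha] of [s] in [A]. Only the term
    indexed by [alpha] can then survive in the sum defining an entry of [AB],
    and it carries the factor [A i alpha], which is zero for [i != s]. So every
    power of [A] is separating, hence has a zero entry as soon as [n >= 2]. *)

Definition separating (R : realType) (m n : nat) (A : tensor R m n) : Prop :=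
  forall s : 'I_n, exists alpha : (m.-1).-tuple 'I_n,
    forall i : 'I_n, s != i -> A i alpha = 0.
Arguments separating {R m n} A.

(** Concatenation: position [x] receives letter [x %% q] of the word [f (x %/ q)]. *)
Lemma block_surj (T : Type) (p q : nat) (f : 'I_p -> q.-tuple T) :
  exists w : (p * q).-tuple T, forall j, block w j = f j.
Proof.
(* For [q = 0] there is no position [x] to fill. *)
have q_gt0 (x : 'I_(p * q)) : (0 < q)%N.
  by case: q x {f} => // -[x]; rewrite muln0.
have divP (x : 'I_(p * q)) : (x %/ q < p)%N by rewrite ltn_divLR // q_gt0.
have modP (x : 'I_(p * q)) : (x %% q < q)%N by rewrite ltn_mod q_gt0.
exists [tuple tnth (f (Ordinal (divP x))) (Ordinal (modP x)) | x < p * q].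
move=> j; apply: eq_from_tnth => l; rewrite !tnth_mktuple.
have q0 : (0 < q)%N by apply: leq_ltn_trans (ltn_ord l).
congr (tnth (f _) _); apply: val_inj => /=.
  by rewrite divnMDl // divn_small // addn0.
by rewrite modnMDl modn_small.
Qed.
Arguments block_surj {T p q} f.

Lemma separating_mul (R : realType) (m k n : nat)
    (A : tensor R m n) (B : tensor R k n) :
  separating A -> separating B -> separating (tensor_mul A B).
Proof.
move=> sepA sepB s; have [alpha A0] := sepA s.
have [beta B0] := fin_all_exists sepB.
have [w wE] := block_surj (fun j => beta (tnth alpha j)).
exists w => i si; apply: big1 => v _.
have [->|neq] := eqVneq v alpha; first by rewrite A0 // mul0r.
(* Where [v] and [alpha] differ, block [j] of [w] is the word of [B] for the letter [tnth alpha j],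
   so its entry in row [tnth v j] is zero. *)
have [j vj] : exists j, tnth alpha j != tnth v j.
  apply/existsP; rewrite -negb_forall; apply: contra neq => /forallP eqv.
  by apply/eqP/eq_from_tnth => j; rewrite (eqP (eqv j)).
by rewrite (bigD1 j) //= wE B0 // mul0r mulr0.
Qed.
Arguments separating_mul {R m k n A B}.

Lemma separating_pow (R : realType) (m n : nat) (A : tensor R m n) (k : nat) :
  separating A -> separating (tensor_pow A k).
Proof.
move=> sepA; elim: k => [|[|k] IHk] //.
exact: separating_mul sepA IHk.
Qed.
Arguments separating_pow {R m n A} k.

Theorem theorem4p2 (R : realType) (m n : nat) (hm : (2 <= m)%N) (hn : (2 <= n)%N)
    (A : tensor R m n) (A_ge0 : nonneg_tensor A)
    (hA : forall s : 'I_n, exists alpha : (m.-1).-tuple 'I_n,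
        forall i : 'I_n, s != i -> A i alpha = 0) :
  ~ strongly_primitive A.
Proof.
move=> [k [_ Ak_gt0]].
(* The word of index 0 gives a zero entry in row 1. *)
have [alpha Ak0] := separating_pow k hA (Ordinal (ltnW hn)).
by have := Ak_gt0 (Ordinal hn) alpha; rewrite Ak0 // ltxx.
Qed.
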